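(* Consider the $K$-armed bandit problem with unit-variance normal rewards, where either $K=N^{\zeta+o(1)}\to\infty$ for some $0<\zeta<1$, or $K$ is fixed (and $\zeta=0$), as $N\to\infty$. Let the algorithm be UCB-Large with confidence bounds $$U_k^n=\bar X_{kn_k}+\sqrt{\frac{2\log(n/K^{1-q})}{n_k}}\quad\text{for some } q>0,\ \text{if } K\to\infty,$$ or $$U_k^n=\bar X_{kn_k}+\sqrt{\frac{2b_{n/K}}{n_k}},\ \text{ with } b_m=\log m+o(\sqrt{\log m})\ \text{as } m\to\infty,\ \text{if } K \text{ is fixed}.$$ For $\Delta_K\to0$ at a sub-polynomial rate, $$\limsup_{N\to\infty}\Big[\sup_{\boldsymbol{\mu}\in\Theta(\Delta_K)}\frac{\widetilde R_N(\boldsymbol{\mu})}{r(\boldsymbol{\mu})\log N}\Big]\ \le\ 1-\zeta+\zeta q$$ (where $\zeta q=0$ if $K$ is fixed).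
   Context: Setting: there are $K=K(N)$ arms and a total of $N$ rewards is to be collected. The rewards $X_{k1},X_{k2},\ldots$ of arm $k$ are i.i.d. $N(\mu_k,1)$, independent across arms; $\boldsymbol{\mu}=(\mu_1,\ldots,\mu_K)\in\mathbb{R}^K$, $\mu_*=\max_k\mu_k$, and $E_{\boldsymbol{\mu}}$ denotes expectation under $\boldsymbol{\mu}$. $\bar X_{kt}=\frac1t\sum_{s=1}^tX_{ks}$. UCB-Large: when there are $n$ total rewards, $n_k$ denotes the number of them from arm $k$. Initialize with one reward from each arm ($n=K$, $n_1=\cdots=n_K=1$). For $n=K,\ldots,N-1$: compute the confidence bounds $U_k^n$, $1\le k\le K$, and draw the next reward from an arm with the largest confidence bound. The function $m\mapsto b_m$ is non-negative and monotone increasing on $[1,\infty)$. $N_k$ is the number of rewards from arm $k$ among the $N$ total rewards. Regret ignoring the initial allocation of one reward to each arm: $\widetilde R_N(\boldsymbol{\mu})=\sum_{k=1}^K(\mu_*-\mu_k)E_{\boldsymbol{\mu}}(N_k-1)^+$, where $a^+=\max(a,0)$. Let $r(\boldsymbol{\mu})=\sum_{k:\mu_k<\mu_*}\frac{2}{\mu_*-\mu_k}$ and $J(\boldsymbol{\mu})=\#\{k:\mu_k<\mu_*\}$. $(\Delta_K)$ is a sequence of positive numbers indexed by the number of arms $K$ (so it is a constant as $N\to\infty$ when $K$ is fixed); $\Delta_K\to0$ at a sub-polynomial rate means that, as $K\to\infty$, $\Delta_K\to0$ and $\Delta_K K^{\epsilon}\to\infty$ for all $\epsilon>0$. $$\Theta(\Delta_K)=\Big\{\boldsymbol{\mu}\in\mathbb{R}^K:\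 \max_{k:\mu_k<\mu_*}\mu_k\le\mu_*-\Delta_K,\ \max_k|\mu_k|\le\Delta_K^{-1},\ J(\boldsymbol{\mu})\ge\Delta_K K\Big\}.$$ (A supremum over an empty parameter set is taken as $0$.) *)

(* Defs.v *)
From HB Require Import structures.
From mathcomp Require Import all_boot all_order all_algebra.
From mathcomp Require Import all_classical all_reals all_analysis.
Import Order.TTheory GRing.Theory Num.Theory.
Import numFieldNormedType.Exports.

Set Implicit Arguments.
Unset Strict Implicit.
Unset Printing Implicit Defensive.

Local Open Scope classical_set_scope.
Local Open Scope ring_scope.

(* The library has no independence of random variables: this is mutual
   independence, the product rule over every finite subfamily. *)
Definition mutually_independent {d} {T : measurableType d} {R : realType}
    (P : probability T R) (I : eqType) (X : I -> {mfun T >-> R}) : Prop :=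
  forall (s : seq I) (B : I -> set R), uniq s -> (forall i, measurable (B i)) ->
    P (\big[setI/setT]_(i <- s) (X i @^-1` B i)) =
    (\prod_(i <- s) P (X i @^-1` B i))%E.

(* A sample space with one law P mu per mean vector mu; X k s is the
   (s+1)-st reward of arm k. Only measurable sets are compared in the marginal
   laws because normal_prob is a measure on those alone. *)
Definition normal_bandit {d} {T : measurableType d} {R : realType} (K : nat)
    (P : ('I_K -> R) -> probability T R)
    (X : 'I_K -> nat -> {mfun T >-> R}) : Prop :=
  forall mu : 'I_K -> R,
    (forall k s (B : set R), measurable B ->
       P mu (X k s @^-1` B) = normal_prob (mu k) 1 B) /\
    mutually_independent (P mu) (fun ks : 'I_K * nat => X ks.1 ks.2).

Section algorithm.
Context {d} {T : measurableType d} {R : realType} (K : nat).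

(* A n is the arm that yields the (n+1)-st reward, so that arm_count A n k is
   the number n_k of rewards from arm k among the first n. *)
Definition arm_count (A : nat -> T -> 'I_K) (n : nat) (k : 'I_K) (w : T) : nat :=
  (\sum_(m < n) (A m w == k))%N.

Definition sample_mean (X : 'I_K -> nat -> {mfun T >-> R}) (k : 'I_K) (t : nat)
    (w : T) : R :=
  t%:R^-1 * \sum_(s < t) X k s w.

Definition ucb (X : 'I_K -> nat -> {mfun T >-> R}) (beta : nat -> R)
    (A : nat -> T -> 'I_K) (n : nat) (k : 'I_K) (w : T) : R :=
  sample_mean X k (arm_count A n k w) w +
  Num.sqrt (2 * beta n / (arm_count A n k w)%:R).

(* A is any run with N rewards in total: the order of the initial K draws and
   the breaking of ties between confidence bounds are left arbitrary. *)
Definition ucb_large (X : 'I_K -> nat -> {mfun T >-> R}) (beta : nat -> R)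
    (A : nat -> T -> 'I_K) (N : nat) : Prop :=
  [/\ forall n k, measurable [set w | A n w = k],
      forall k w, arm_count A K k w = 1%N &
      forall n k w, (K <= n < N)%N ->
        ucb X beta A n k w <= ucb X beta A n (A n w) w].

End algorithm.

Section parameters.
Context {R : realType} (K : nat).

(* The supremum of a finite family, attained as soon as 0 < K. *)
Definition mu_star (mu : 'I_K -> R) : R := sup (range mu).

Definition regret {d} {T : measurableType d} (P : ('I_K -> R) -> probability T R)
    (A : nat -> T -> 'I_K) (N : nat) (mu : 'I_K -> R) : \bar R :=
  (\sum_(k < K) (mu_star mu - mu k)%R%:E *
     'E_(P mu)[fun w => Num.max ((arm_count A N k w)%:R - 1)%R 0%R])%E.

Definition r_coef (mu : 'I_K -> R) : R :=
  \sum_(k < K | mu k < mu_star mu) 2 / (mu_star mu - mu k).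

Definition num_inferior (mu : 'I_K -> R) : nat :=
  #|[pred k | mu k < mu_star mu]|.

Definition Theta (Delta : R) : set ('I_K -> R) :=
  [set mu | [/\ forall k, mu k < mu_star mu -> mu k <= mu_star mu - Delta,
                forall k, `|mu k| <= Delta^-1 &
                Delta * K%:R <= (num_inferior mu)%:R]].

End parameters.

(* ereal_sup set0 is -oo; here the empty supremum is 0. *)
Definition nneg_ereal_sup {R : realType} (S : set (\bar R)) : \bar R :=
  if `[< S = set0 >] then 0%E else ereal_sup S.

Definition subpolynomial_to0 {R : realType} (Delta : nat -> R) : Prop :=
  Delta k @[k --> \oo] --> 0 /\
  forall eps : R, 0 < eps -> Delta k * k%:R `^ eps @[k --> \oo] --> +oo.

(* Main.v *)
(* If arm k, with gap delta, is drawn at time n, then either the confidence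
   bound of a best arm has dropped below mu_star - eta * delta, or that of arm k
   is still above this level. Once arm k has more than 2 beta / ((1 - 2 eta)
   delta)^2 rewards, the second case needs a deviation by eta * delta of its
   sample mean; by Chernoff's bound the expected number of such t is at most
   2 / (eta delta)^2, which is o(log N / delta^2). Multiplying by delta and
   summing over k gives (1 + o(1)) r(mu) beta.
   In the first case it suffices to count over all arms at once, since only one
   arm is drawn at each time: by Chernoff again, the best arm is below the level
   mu_star - eta * Delta at time n with probability at most
   2 / (eta Delta)^2 * exp (- beta_n - eta Delta sqrt (2 beta_n)). For growing K
   the factor exp (- beta_n) = K^(1 - q) / n leaves, after the harmonic sum, a
   term of order K^(1 - q) log N up to powers of Delta, which is negligible
   against r(mu) log N >= Delta^2 K log N; for fixed K the factor
   exp (- eta Delta sqrt (2 beta_n)) absorbs the error exp (o (sqrt (log n))) in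
   exp (- beta_n), so the summand is o(1 / n). *)

Require Import Defs.
From HB Require Import structures.
From mathcomp Require Import all_boot all_order all_algebra.
From mathcomp Require Import all_classical all_reals all_analysis.
From mathcomp Require Import measurable_realfun ring lra.
Import Order.TTheory GRing.Theory Num.Theory.
Import numFieldNormedType.Exports.

Set Implicit Arguments.
Unset Strict Implicit.
Unset Printing Implicit Defensive.

Local Open Scope classical_set_scope.
Local Open Scope ring_scope.

(** * Exponential moments of independent normal rewards *)

Section density.
Local Open Scope ereal_scope.
Import HBNNSimple.
Context d1 d2 (T : measurableType d1) (U : measurableType d2) (R : realType).
Variables (mu : {measure set T -> \bar R}) (nu : {measure set U -> \bar R}).
Variables (Y : T -> U) (mY : measurable_fun setT Y).
Variables (g : T -> R) (mg : measurable_fun setT g).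
Hypothesis g_ge0 : forall x, (0 <= g x)%R.
Variables (c : R) (c_ge0 : (0 <= c)%R).
Hypothesis gE : forall B, measurable B ->
  \int[mu]_(x in Y @^-1` B) (g x)%:E = c%:E * nu B.

(** [gE] is the case of indicators; linearity gives simple functions and monotone convergence the
    rest. It serves twice: with [g] built from independent factors, and with [g] a normal
    density. *)
Lemma ge0_integral_density (f : U -> R) :
  measurable_fun setT f -> (forall y, 0 <= f y)%R ->
  \int[mu]_x (g x * f (Y x))%:E = c%:E * \int[nu]_y (f y)%:E.
Proof.
move=> mf f0; have /measurable_EFinP mfE := mf.
pose f_ := nnsfun_approx measurableT mfE.
have fcvg y : (f_ n y)%:E @[n --> \oo] --> (f y)%:E.
  by apply: (cvg_nnsfun_approx measurableT mfE _ (x := y)) => // x _; rewrite lee_fin.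
have fnd y : {homo (fun n => (f_ n y)%:E) : m n / (m <= n)%N >-> m <= n}.
  by move=> m n mn; rewrite lee_fin; exact/lefP/nd_nnsfun_approx.
have simple n : \int[mu]_x (g x * f_ n (Y x))%:E = c%:E * \int[nu]_y (f_ n y)%:E.
  transitivity (\sum_(k \in range (f_ n))
      \int[mu]_x (k%:E * (g x * \1_(Y @^-1` (f_ n @^-1` [set k])) x)%:E)).
    rewrite -ge0_integral_fsum//; last 2 first.
    - move=> r; apply/measurable_EFinP; do 2 apply: measurable_funM => //.
      apply: measurable_indic.
      by rewrite -[X in measurable X]setTI; exact: mY.
    - move=> r x _; rewrite EFinM muleCA mule_ge0 ?lee_fin//.
      exact: (@nnfun_muleindic_ge0 _ _ _ (f_ n) r (Y x)).
    apply: eq_integral => x _; rewrite fimfunE EFinM -fsumEFin// ge0_mule_fsumr//.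
      by apply: eq_fsbigr => r _; rewrite !EFinM muleCA; congr (_ * (_ * _%:E)); rewrite !indicE.
    by move=> r; exact: nnfun_muleindic_ge0.
  transitivity (\sum_(k \in range (f_ n)) (k%:E * (c%:E * nu (f_ n @^-1` [set k])))).
    apply: eq_fsbigr => r /[!inE] -[y _ <-{r}].
    have mB : measurable (Y @^-1` (f_ n @^-1` [set f_ n y])).
      by rewrite -[X in measurable X]setTI; exact: mY.
    rewrite ge0_integralZl//; last 3 first.
    - by apply/measurable_EFinP; exact: measurable_funM.
    - by move=> x _; rewrite lee_fin mulr_ge0.
    - by rewrite lee_fin.
    rewrite -gE// [in RHS]integral_mkcond; congr (_ * _).
    apply: eq_integral => x _; rewrite patchE indicE.
    by case: ifPn; rewrite ?mulr1 ?mulr0.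
  transitivity (c%:E * \sum_(k \in range (f_ n)) (k%:E * nu (f_ n @^-1` [set k]))).
    rewrite ge0_mule_fsumr//; last by move=> r; exact: nnsfun_mulemu_ge0.
    by apply: eq_fsbigr => r _; rewrite muleCA.
  by rewrite integral_nnsfun// patch_setT sintegralE.
(* One passage to the limit covers both sides: weight [g] and map [Y] under [mu], weight 1 and the
   identity under [nu]. *)
have mono d (V : measurableType d) (m : {measure set V -> \bar R}) (h : V -> R)
    (Z : V -> U) : measurable_fun setT h -> (forall x, 0 <= h x)%R -> measurable_fun setT Z ->
    \int[m]_x (h x * f_ n (Z x))%:E @[n --> \oo] --> \int[m]_x (h x * f (Z x))%:E.
  move=> mh h0 mZ.
  have -> : \int[m]_x (h x * f (Z x))%:E =
      \int[m]_x (limn (fun n => (h x * f_ n (Z x))%:E)).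
    apply: eq_integral => x _; apply/esym/cvg_lim => //; rewrite EFinM.
    by under eq_fun do rewrite EFinM; exact: cvgeZl.
  apply: cvg_monotone_convergence => //.
  - move=> n; apply/measurable_EFinP; apply: measurable_funM => //.
    exact: measurableT_comp.
  - by move=> n x _; rewrite lee_fin mulr_ge0.
  - by move=> x _ p n pn; rewrite !EFinM lee_wpmul2l ?lee_fin//; exact: fnd.
have cvg1 := mono _ _ mu g Y mg g_ge0 mY.
have cvg2 : c%:E * \int[nu]_y (f_ n y)%:E @[n --> \oo] --> c%:E * \int[nu]_y (f y)%:E.
  apply: cvgeZl => //.
  have cst1_ge0 (y : U) : (0 <= cst (1 : R) y)%R by [].
  have := mono _ _ nu _ id (measurable_cst _) cst1_ge0 (@measurable_id _ _ _).
  by under eq_fun do under eq_integral do rewrite mul1r;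
    under eq_integral do rewrite mul1r.
move: cvg1; rewrite (eq_cvg _ _ simple) => cvg1.
exact: (cvg_unique (@ereal_hausdorff R) cvg1 cvg2).
Qed.

End density.

(** * Expectation of a product of independent factors *)

Section independence.
Local Open Scope ereal_scope.
Context d d' (T : measurableType d) (U : measurableType d') (R : realType).
Variables (P : probability T R) (I : eqType) (X : I -> T -> U).
Hypothesis mX : forall i, measurable_fun setT (X i).
Variables (nu : I -> {measure set U -> \bar R}).
Hypothesis XE : forall i B, measurable B -> P (X i @^-1` B) = nu i B.
Hypothesis XI : forall (s : seq I) (B : I -> set U), uniq s ->
  (forall i, measurable (B i)) ->
  P (\big[setI/setT]_(i <- s) (X i @^-1` B i)) = \prod_(i <- s) P (X i @^-1` B i).
Variables (f : I -> U -> R) (m : I -> R).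
Hypothesis mf : forall i, measurable_fun setT (f i).
Hypothesis f_ge0 : forall i x, (0 <= f i x)%R.
Hypothesis fE : forall i, \int[nu i]_x (f i x)%:E = (m i)%:E.

Let m_ge0 i : (0 <= m i)%R.
Proof.
by rewrite -lee_fin -fE; apply: integral_ge0 => x _; rewrite lee_fin.
Qed.

Let mX_preimage i B : measurable B -> measurable (X i @^-1` B).
Proof. by move=> mB; rewrite -[_ @^-1` _]setTI; exact: mX. Qed.

Let measurable_bigcap_preimage (s : seq I) B : (forall i, measurable (B i)) ->
  measurable (\big[setI/setT]_(i <- s) (X i @^-1` B i)).
Proof. by move=> mB; apply: bigsetI_measurable => i _; exact: mX_preimage. Qed.

(* The events indexed by s2 carry the induction on s1: a factor f i (X i) is
   traded for an event by ge0_integral_density. *)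
Lemma integral_prod_bigcap (s1 s2 : seq I) (B : I -> set U) :
  uniq (s1 ++ s2) -> (forall i, measurable (B i)) ->
  \int[P]_(w in \big[setI/setT]_(i <- s2) (X i @^-1` B i))
    (\prod_(i <- s1) f i (X i w))%:E =
  (\prod_(i <- s1) m i)%:E * \prod_(i <- s2) P (X i @^-1` B i).
Proof.
elim: s1 s2 B => [|i s1 IH] s2 B.
  move=> us2 mB; rewrite big_nil mul1e -XI//.
  under eq_integral do rewrite big_nil.
  by rewrite integral_cst ?mul1e//; exact: measurable_bigcap_preimage.
rewrite cat_cons cons_uniq mem_cat negb_or => /andP[/andP[is1 is2] us] mB.
set E := \big[setI/setT]_(_ <- s2) _.
have mE : measurable E by exact: measurable_bigcap_preimage.
set Q := \prod_(_ <- s2) _.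
have QE : Q = (fine (P E))%:E.
  by rewrite fineK ?fin_num_measure// /Q -XI//; move: us; rewrite cat_uniq => /and3P[].
pose g w := (\prod_(j <- s1) f j (X j w) * \1_E w)%R.
rewrite integral_mkcond.
transitivity (\int[P]_w (g w * f i (X i w))%:E).
  apply: eq_integral => w _; rewrite patchE /g indicE big_cons.
  by case: ifPn => _; rewrite ?mulr1 ?mulr0 ?mul0r 1?mulrC.
rewrite (@ge0_integral_density _ _ _ _ _ P (nu i) (X i) _ g _ _
   (\prod_(j <- s1) m j * fine (P E))%R)//.
- by rewrite fE QE -!EFinM big_cons mulrC mulrA.
- apply: measurable_funM; last exact: measurable_indic.
  by apply: measurable_prod => j _; apply: measurableT_comp.
- by move=> w; apply: mulr_ge0 => //; exact: prodr_ge0.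
move=> C mC.
(* The density hypothesis for factor [i] is the induction hypothesis at [i :: s2], with the
   arbitrary event [C] at [i]; the other events are unchanged because [i] is not in [s2]. *)
pose B' j := if j == i then C else B j.
have mB' j : measurable (B' j) by rewrite /B'; case: ifP.
have B'i : B' i = C by rewrite /B' eqxx.
have B'E : \big[setI/setT]_(j <- i :: s2) (X j @^-1` B' j) = X i @^-1` C `&` E.
  rewrite big_cons B'i; congr (_ `&` _); apply: eq_big_seq => j js2.
  by rewrite /B'; case: eqP => // ji; rewrite -ji js2 in is2.
have /IH/(_ mB') : uniq (s1 ++ i :: s2).
  by rewrite -cat1s uniq_catCA /= mem_cat negb_or is1 is2.
rewrite B'E big_cons B'i XE// => h.
transitivity (\int[P]_(w in X i @^-1` C `&` E) (\prod_(j <- s1) f j (X j w))%:E).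
  rewrite integral_mkcond [RHS]integral_mkcond; apply: eq_integral => w _.
  rewrite !patchE in_setI /g indicE.
  by case: (w \in X i @^-1` C) => //=; case: (w \in E); rewrite ?mulr1 ?mulr0.
have Q'E : \prod_(j <- s2) P (X j @^-1` B' j) = Q.
  by apply: eq_big_seq => j js2; rewrite /B'; case: eqP => // ji; rewrite -ji js2 in is2.
by rewrite h Q'E EFinM -QE -muleA [nu i C * Q]muleC.
Qed.

Lemma integral_prod_independent (s : seq I) : uniq s ->
  \int[P]_w (\prod_(i <- s) f i (X i w))%:E = (\prod_(i <- s) m i)%:E.
Proof.
move=> us.
have := @integral_prod_bigcap s [::] (fun=> setT).
by rewrite cats0 !big_nil mule1; apply.
Qed.

End independence.

(** * Moment generating function of the normal law *)

Section normal_mgf.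
Context {R : realType}.
Implicit Types m l : R.

(** Completing the square: an exponential tilt only shifts the mean by [l]. *)
Lemma normal_pdf1_tilt m l x :
  normal_pdf m 1 x * expR (l * (x - m)) = expR (l ^+ 2 / 2) * normal_pdf (m + l) 1 x.
Proof.
rewrite !normal_pdfE ?oner_eq0// /normal_fun -mulrA [RHS]mulrCA; congr (_ * _).
by rewrite -!expRD; congr expR; field.
Qed.

Lemma integral_normal_prob1_expR m l :
  (\int[normal_prob m 1]_x (expR (l * (x - m)))%:E = (expR (l ^+ 2 / 2))%:E)%E.
Proof.
have mexp : measurable_fun setT (fun x : R => expR (l * (x - m))).
  apply: measurableT_comp => //; apply: measurable_funM => //.
  exact: measurable_funB.
(* The factor 1 is the constant [c] of the density lemma, applied with the identity map to pass from
   the normal law to Lebesgue measure. *)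
rewrite -[LHS]mul1e.
rewrite -(@ge0_integral_density _ _ _ _ _ lebesgue_measure (normal_prob m 1) id _
  (normal_pdf m 1) _ _ 1%R)//; first last.
- by move=> B mB; rewrite mul1e.
- by move=> x; exact: normal_pdf_ge0.
- exact: measurable_normal_pdf.
under eq_integral do rewrite normal_pdf1_tilt EFinM.
rewrite ge0_integralZl ?lee_fin//.
- by rewrite integral_normal_pdf mule1.
- by apply/measurable_EFinP; exact: measurable_normal_pdf.
- by move=> x _; rewrite lee_fin normal_pdf_ge0.
Qed.

End normal_mgf.

Section bandit_mgf.
Context d (T : measurableType d) (R : realType) (K : nat).
Variables (P : ('I_K -> R) -> probability T R) (X : 'I_K -> nat -> {mfun T >-> R}).
Hypothesis PX : normal_bandit P X.
Variable mu : 'I_K -> R.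

Lemma measurable_sum_dev k t l :
  measurable_fun setT (fun w => expR (l * \sum_(s < t) (X k s w - mu k))).
Proof.
apply: measurableT_comp => //; apply: measurable_funM => //.
by apply: measurable_sum => s; exact: measurable_funB.
Qed.

Lemma integral_expR_sum_dev k t l :
  (\int[P mu]_w (expR (l * \sum_(s < t) (X k s w - mu k)))%:E =
   (expR (l ^+ 2 / 2 * t%:R))%:E)%E.
Proof.
have [law ind] := PX mu.
pose nu (i : 'I_K * nat) : {measure set (measurableTypeR R) -> \bar R} :=
  normal_prob (mu i.1) 1.
pose f (i : 'I_K * nat) (x : measurableTypeR R) : R := expR (l * (x - mu i.1)).
(* R carries a different measurable display than the domain of normal_prob. *)
pose Y (i : 'I_K * nat) : T -> measurableTypeR R := X i.1 i.2.
have mY i : measurable_fun setT (Y i) 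
  by move=> mT B mB; exact: (measurable_funP (X i.1 i.2) mT B mB).
have := @integral_prod_independent _ _ _ _ _ (P mu) _ Y mY nu
  (fun i => law i.1 i.2) ind f (fun=> expR (l ^+ 2 / 2)) _ _
  (fun i => integral_normal_prob1_expR (mu i.1) l) [seq (k, s) | s <- iota 0 t].
have H : uniq [seq (k, s) | s <- iota 0 t].
  by rewrite map_inj_uniq ?iota_uniq// => s s' [].
move=> /(_ _ _ H).
rewrite big_map big_const_seq count_predT size_iota iter_mulr_1 -expRM_natr => <-.
- apply: eq_integral => w _; congr (_%:E).
  rewrite mulr_sumr expR_sum big_map /f/=.
  by rewrite -(big_mkord xpredT (fun s => expR (l * (X k s w - mu k)))) /index_iota subn0.
- move=> i; apply: measurableT_comp => //; apply: measurable_funM => //.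
  exact: measurable_funB.
- by move=> i x; exact: expR_ge0.
Qed.

End bandit_mgf.

(** * Bounds at a fixed horizon *)

(** A geometric series. Keeping the remainder [expR (- (c * m%:R))] makes the induction close, each
    step being [1 + c <= expR c]. *)
Lemma sum_expRN_le (R : realType) (c : R) (n : nat) : 0 < c ->
  \sum_(1 <= t < n) expR (- (c * t%:R)) <= c^-1.
Proof.
move=> c0.
suff H m : \sum_(1 <= t < m.+1) expR (- (c * t%:R)) <= (1 - expR (- (c * m%:R))) / c.
  case: n => [|n]; first by rewrite big_geq// invr_ge0 ltW.
  apply: (le_trans (H n)); apply: ler_piMl; first by rewrite invr_ge0 ltW.
  by rewrite gerBl expR_ge0.
elim: m => [|m IH]; first by rewrite big_geq// mulr0 oppr0 expR0 subrr mul0r.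
rewrite big_nat_recr//=; apply: (le_trans (lerD IH (lexx _))).
rewrite ler_pdivlMr// mulrDl divfK ?gt_eqF//.
have -> : expR (- (c * m%:R)) = expR c * expR (- (c * m.+1%:R)).
  by rewrite -expRD; congr expR; rewrite -natr1; ring.
have e0 := expR_gt0 (- (c * m.+1%:R)).
have := ler_wpM2r (ltW e0) (expR_ge1Dx c); lra.
Qed.

(** The induction also carries the trivial bound by the number of terms, which settles the case
    where the newest integer is below [x]. *)
Lemma sum_nat_lt_le (R : realType) (x : R) (n : nat) : 0 <= x ->
  \sum_(1 <= t < n) (t%:R < x)%R%:R <= x.
Proof.
move=> x0; case: n => [|n]; first by rewrite big_geq.
suff H : \sum_(1 <= t < n.+1) ((t%:R : R) < x)%R%:R <= x /\
    \sum_(1 <= t < n.+1) ((t%:R : R) < x)%R%:R <= n%:R :> R by case: H.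
elim: n => [|n [IH1 IH2]]; first by rewrite big_geq.
rewrite big_nat_recr//=.
case: ltP => [nx|nx]; rewrite ?addr0; split => //.
- by apply: le_trans (ltW nx); rewrite -natr1 lerD2r.
- by rewrite -natr1 lerD2r.
- by apply: (le_trans IH2); rewrite ler_nat.
Qed.

(** * Counting the draws of one arm *)

Section counting.
Context d (T : measurableType d) (R : realType) (K : nat).
Variable A : nat -> T -> 'I_K.

Lemma arm_countS n k w :
  arm_count A n.+1 k w = (arm_count A n k w + (A n w == k))%N.
Proof. by rewrite /arm_count big_ord_recr. Qed.

Lemma arm_count_le n k w : (arm_count A n k w <= n)%N.
Proof.
elim: n => [|n IH]; first by rewrite /arm_count big_ord0.
by rewrite arm_countS -addn1 leq_add// leq_b1.
Qed.

Lemma arm_count_homo k w : {homo (fun n => arm_count A n k w) : m n / (m <= n)%N}.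
Proof.
apply: homo_leq; [by []|exact: leq_trans|].
by move=> n; rewrite arm_countS leq_addr.
Qed.

Hypothesis A1 : forall k w, arm_count A K k w = 1%N.

Lemma arm_count_gt0 n k w : (K <= n)%N -> (0 < arm_count A n k w)%N.
Proof. by move=> Kn; rewrite -(A1 k w) arm_count_homo. Qed.

(** After the initial draws, successive draws of arm [k] find its count at 1, 2, 3 and so on, each
    value once. A sum over random times thus becomes a sum over counts. *)
Lemma sum_draws (F : nat -> R) n k w : (K <= n)%N ->
  \sum_(K <= m < n | A m w == k) F (arm_count A m k w) =
  \sum_(1 <= t < arm_count A n k w) F t.
Proof.
elim: n => [|n IH].
  rewrite leqn0 => /eqP K0; rewrite big_geq//.
  by rewrite big_geq// (leq_trans (arm_count_le _ _ _)).
rewrite leq_eqVlt => /predU1P[Kn|]; first by rewrite -Kn A1 !big_geq.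
rewrite ltnS => Kn; rewrite big_mkcond big_nat_recr//= -big_mkcond IH//.
rewrite arm_countS; case: (A n w == k); last by rewrite addr0 addn0.
by rewrite addn1 big_nat_recr// arm_count_gt0.
Qed.

Lemma arm_countB1 n k w : (K <= n)%N ->
  Num.max ((arm_count A n k w)%:R - 1) 0 = \sum_(K <= m < n | A m w == k) 1 :> R.
Proof.
move=> Kn; rewrite (sum_draws (fun=> 1))// sumr_const_nat.
have h := arm_count_gt0 k w Kn.
by rewrite natrB// max_l// subr_ge0 ler1n.
Qed.

End counting.

Section ge0_integrates_to.
Context d (T : measurableType d) (R : realType) (P : probability T R).

(** Bundling the side conditions with the value lets nested sums of weights be integrated by
    following their syntax. *)
Definition ge0_integrates_to (f : T -> R) (c : R) : Prop :=
  [/\ measurable_fun setT f, forall x, 0 <= f x & (\int[P]_x (f x)%:E = c%:E)%E].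

Lemma ge0_integrates_to_cst c : 0 <= c -> ge0_integrates_to (cst c) c.
Proof.
move=> c0; split=> //.
by rewrite -[RHS]mule1 -(@probability_setT _ _ _ P) -integral_cst.
Qed.

Lemma ge0_integrates_toD f g a b : ge0_integrates_to f a -> ge0_integrates_to g b ->
  ge0_integrates_to (fun x => f x + g x) (a + b).
Proof.
move=> [mf f0 fa] [mg g0 gb]; split.
- exact: measurable_funD.
- by move=> x; rewrite addr_ge0.
- under eq_integral do rewrite EFinD.
  rewrite ge0_integralD ?fa ?gb//; try by move=> x _; rewrite lee_fin.
  + exact/measurable_EFinP.
  + exact/measurable_EFinP.
Qed.

Lemma ge0_integrates_toZ f a c : 0 <= c -> ge0_integrates_to f a ->
  ge0_integrates_to (fun x => c * f x) (c * a).
Proof.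
move=> c0 [mf f0 fa]; split.
- exact: measurable_funM.
- by move=> x; rewrite mulr_ge0.
- under eq_integral do rewrite EFinM.
  rewrite ge0_integralZl ?lee_fin ?fa//.
  + exact/measurable_EFinP.
  + by move=> x _; rewrite lee_fin.
Qed.

Lemma ge0_integrates_to_sum (I : Type) (s : seq I) (Q : pred I) (f : I -> T -> R)
    (c : I -> R) : (forall i, Q i -> ge0_integrates_to (f i) (c i)) ->
  ge0_integrates_to (fun x => \sum_(i <- s | Q i) f i x) (\sum_(i <- s | Q i) c i).
Proof.
move=> fc; elim: s => [|i s IH].
  rewrite big_nil; under eq_fun do rewrite big_nil.
  exact: ge0_integrates_to_cst.
rewrite big_cons; under eq_fun do rewrite big_cons.
by case: ifPn => // Qi; apply: ge0_integrates_toD => //; exact: fc.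
Qed.

End ge0_integrates_to.

Lemma measurable_arm_count d (T : measurableType d) (R : realType) (K : nat)
    (A : nat -> T -> 'I_K) n k : (forall n k, measurable [set w | A n w = k]) ->
  measurable_fun setT (fun w => (arm_count A n k w)%:R : R).
Proof.
move=> mA.
rewrite (_ : (fun _ => _) = fun w => \sum_(m < n) \1_[set w | A m w = k] w).
  by apply: measurable_sum => m; exact: measurable_indic.
apply/funext => w; rewrite /arm_count natr_sum; apply: eq_bigr => m _.
rewrite indicE; congr (_%:R); case: eqP => h; first by rewrite mem_set.
by rewrite memNset.
Qed.

(** * Pathwise domination of the regret and its expectation *)

Section fixed_horizon.
Context d (T : measurableType d) (R : realType) (K : nat).
Variables (P : ('I_K -> R) -> probability T R) (X : 'I_K -> nat -> {mfun T >-> R}).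
Hypothesis PX : normal_bandit P X.
Variables (beta : nat -> R) (A : nat -> T -> 'I_K) (N : nat).
Hypothesis ucbA : ucb_large X beta A N.
Hypothesis KN : (K < N)%N.
Variables (mu : 'I_K -> R) (j : 'I_K).
Hypothesis mu_j : forall k, mu k <= mu j.
Variables (D G B eta : R).
Hypothesis D_gt0 : 0 < D.
Hypothesis gap_ge : forall k, mu k < mu j -> D <= mu j - mu k.
Hypothesis gap_le : forall k, mu j - mu k <= G.
Hypothesis beta_ge0 : forall n, (K <= n < N)%N -> 0 <= beta n.
Hypothesis beta_le : forall n, (K <= n < N)%N -> beta n <= B.
Hypothesis eta_gt0 : 0 < eta.
Hypothesis eta_lt : 2 * eta < 1.

Let sum_dev k t w : R := \sum_(s < t) (X k s w - mu k).

(* Exponential weights replacing indicators: [over k t] is at least 1 when the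
   mean of the first t rewards of arm k exceeds mu k by [dev k], and [under n s]
   is at least 1 when the confidence bound at time n of the best arm j, after s
   rewards, falls below mu j - eta * D. After [burn k] rewards, arm k can only
   be drawn on one of these two events. *)
Let dev k := eta * (mu j - mu k).
Let over k t w := expR (dev k * sum_dev k t w) * expR (- (t%:R * dev k ^+ 2)).
Let dip n s := eta * D + Num.sqrt (2 * beta n / s%:R).
Let under n s w := expR (- dip n s * sum_dev j s w) * expR (- (s%:R * dip n s ^+ 2)).
Let burn k := 2 * B / ((1 - 2 * eta) * (mu j - mu k)) ^+ 2.

Let sum_devE k t w : (0 < t)%N -> sum_dev k t w = t%:R * (sample_mean X k t w - mu k).
Proof.
move=> t0; rewrite /sum_dev sumrB sumr_const card_ord mulrBr /sample_mean mulrA.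
by rewrite divff ?mul1r ?mulr_natl// pnatr_eq0 -lt0n.
Qed.

Let over_ge0 k t w : 0 <= over k t w.
Proof. by rewrite mulr_ge0 ?expR_ge0. Qed.

Let under_ge0 n s w : 0 <= under n s w.
Proof. by rewrite mulr_ge0 ?expR_ge0. Qed.

Let gap_ge0 k : 0 <= mu j - mu k. Proof. by rewrite subr_ge0. Qed.

Let B_ge0 : 0 <= B.
Proof.
apply: (@le_trans _ _ (beta K)); [apply: beta_ge0|apply: beta_le];
by rewrite leqnn.
Qed.

(** If neither sample mean deviates, comparing the confidence bounds of [j] and [k] forces arm [k]
    to have few rewards. The count of arm [j] is random, hence the sum over all its possible values
    [s]. *)
Let draw_le n k w : (K <= n < N)%N -> A n w = k -> mu k < mu j ->
  1 <= ((arm_count A n k w)%:R < burn k)%R%:R + over k (arm_count A n k w) w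
       + \sum_(1 <= s < N) under n s w.
Proof.
move=> nKN Ank kj; have [_ A1 Amax] := ucbA.
have [Kn nN] := andP nKN.
set t := arm_count A n k w; set s := arm_count A n j w.
have t0 : (0 < t)%N by exact: arm_count_gt0.
have s0 : (0 < s)%N by exact: arm_count_gt0.
have gapD := gap_ge kj.
have under_sum : under n s w <= \sum_(1 <= s < N) under n s w.
  rewrite (bigD1_seq s)/= ?iota_uniq//.
    by rewrite lerDl sumr_ge0.
  by rewrite mem_index_iota s0 (leq_ltn_trans (arm_count_le _ _ _ _)).
have tR : 0 < t%:R :> R by rewrite ltr0n.
have sR : 0 < s%:R :> R by rewrite ltr0n.
have [low|high] := leP (sample_mean X j s w - mu j) (- dip n s).
  suff : 1 <= under n s w.
    by have := over_ge0 k t w; have : 0 <= (t%:R < burn k)%R%:R :> R by []; lra.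
  rewrite /under -expRD -[leLHS]expR0 ler_expR sum_devE//.
  have dip0 : 0 <= dip n s.
    by rewrite addr_ge0 ?sqrtr_ge0// mulr_ge0// ltW.
  set u := sample_mean X j s w - mu j in low *.
  have -> : - dip n s * (s%:R * u) + - (s%:R * dip n s ^+ 2) =
    s%:R * dip n s * (- dip n s - u) by ring.
  by apply: mulr_ge0; [exact: mulr_ge0|rewrite subr_ge0].
have sum_under_ge0 : 0 <= \sum_(1 <= s < N) under n s w by rewrite sumr_ge0.
have gap0 : 0 < mu j - mu k by rewrite subr_gt0.
have [kdev|kdev] := leP (dev k) (sample_mean X k t w - mu k).
  suff : 1 <= over k t w by have : 0 <= (t%:R < burn k)%R%:R :> R by []; lra.
  rewrite /over -expRD -[leLHS]expR0 ler_expR sum_devE//.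
  set u := sample_mean X k t w - mu k in kdev *.
  have -> : dev k * (t%:R * u) + - (t%:R * dev k ^+ 2) = t%:R * dev k * (u - dev k) by ring.
  apply: mulr_ge0; last by rewrite subr_ge0.
  by rewrite mulr_ge0// mulr_ge0 ?ltW.
suff -> : t%:R < burn k.
  by rewrite mulr1n -addrA lerDl addr_ge0.
have Ujk := Amax n j w nKN.
rewrite Ank /ucb -/t -/s in Ujk.
have bn0 := beta_ge0 nKN; have bnB := beta_le nKN.
(* Each of the two arms costs at most [eta] times the gap; for arm [j] this uses that [D] is at most
   the gap. *)
have gapk : (1 - 2 * eta) * (mu j - mu k) < Num.sqrt (2 * beta n / t%:R).
  have : eta * D <= eta * (mu j - mu k) by rewrite ler_pM2l.
  move: high kdev Ujk; rewrite /dip /dev; lra.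
have c0 : 0 < (1 - 2 * eta) * (mu j - mu k) by rewrite mulr_gt0// subr_gt0.
rewrite /burn ltr_pdivlMr ?exprn_gt0//.
have : ((1 - 2 * eta) * (mu j - mu k)) ^+ 2 < 2 * beta n / t%:R.
  rewrite -[ltRHS]sqr_sqrtr; first by rewrite ltr_pXn2r// nnegrE ?sqrtr_ge0// ltW.
  by rewrite divr_ge0 ?mulr_ge0.
rewrite ltr_pdivlMr// mulrC => /lt_le_trans; apply.
by rewrite ler_pM2l.
Qed.

Let burn_ge0 k : 0 <= burn k.
Proof. by rewrite /burn divr_ge0 ?sqr_ge0 ?mulr_ge0 ?B_ge0. Qed.

(** Sum [draw_le] over the draws of arm [k]. The first two terms depend on time only through the
    count, so [sum_draws] removes the randomness of the times; the third stays indexed by time. *)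
Let draws_le k w : mu k < mu j ->
  Num.max ((arm_count A N k w)%:R - 1) 0 <=
  burn k + \sum_(1 <= t < N) over k t w +
  \sum_(K <= n < N | A n w == k) \sum_(1 <= s < N) under n s w.
Proof.
move=> kj; have [_ A1 _] := ucbA; rewrite (arm_countB1 _ A1) ?(ltnW KN)//.
apply: (@le_trans _ _ (\sum_(K <= n < N | A n w == k)
  ((fun t => (t%:R < burn k)%R%:R + over k t w) (arm_count A n k w)
   + \sum_(1 <= s < N) under n s w))).
  rewrite big_nat_cond [leRHS]big_nat_cond; apply: ler_sum => n /andP[nKN /eqP Ank].
  exact: draw_le.
rewrite big_split/= lerD2r (sum_draws A1 (fun t => (t%:R < burn k)%R%:R + over k t w)) ?(ltnW KN)//.
apply: (@le_trans _ _ (\sum_(1 <= t < N) ((t%:R < burn k)%R%:R + over k t w))).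
  rewrite [leRHS](big_cat_nat (n := arm_count A N k w))/= ?arm_count_le ?arm_count_gt0 1?ltnW//.
  rewrite lerDl.
  by rewrite sumr_ge0// => t _; rewrite addr_ge0.
by rewrite big_split/= lerD2r sum_nat_lt_le// burn_ge0.
Qed.

Let measurable_over k t : measurable_fun setT (over k t).
Proof. by apply: measurable_funM => //; exact: measurable_sum_dev. Qed.

Let measurable_under n s : measurable_fun setT (under n s).
Proof. by apply: measurable_funM => //; exact: measurable_sum_dev. Qed.

(** Chernoff's bound for threshold [x] at its optimal tilt, which is [x] itself: the exponents
    [t * x ^+ 2 / 2] and [- t * x ^+ 2] add up. *)
Let integral_weight k t x :
  (\int[P mu]_w (expR (x * sum_dev k t w) * expR (- (t%:R * x ^+ 2)))%:E =
   (expR (- (x ^+ 2 / 2 * t%:R)))%:E)%E.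
Proof.
under eq_integral do rewrite mulrC EFinM.
rewrite ge0_integralZl ?lee_fin ?expR_ge0//; last first.
  by apply/measurable_EFinP; exact: measurable_sum_dev.
rewrite (integral_expR_sum_dev PX) -EFinM -expRD; congr (expR _)%:E.
by field.
Qed.

(** Expand the square in [dip]. The cross term carries a factor [sqrt s >= 1], which is dropped;
    what remains splits into a factor free of [s] and one geometric in [s]. *)
Let integral_under_le n s : (K <= n < N)%N -> (0 < s)%N ->
  expR (- (dip n s ^+ 2 / 2 * s%:R)) <=
  expR (- beta n - eta * D * Num.sqrt (2 * beta n)) * expR (- ((eta * D) ^+ 2 / 2 * s%:R)).
Proof.
move=> nKN s0; rewrite -expRD ler_expR.
have b0 := beta_ge0 nKN; have s1 : 1 <= s%:R :> R by rewrite ler1n.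
rewrite /dip sqrtrM ?mulr_ge0// sqrtrV ?ler0n//.
set r := Num.sqrt (2 * beta n); set q := Num.sqrt s%:R.
have r0 : 0 <= r by exact: sqrtr_ge0.
have r2 : r ^+ 2 = 2 * beta n by rewrite sqr_sqrtr// mulr_ge0.
have q2 : q ^+ 2 = s%:R by rewrite sqr_sqrtr// (le_trans ler01).
have q1 : 1 <= q by rewrite -(sqrtr1 R) ler_wsqrtr.
have q0 : q != 0 by rewrite gt_eqF// (lt_le_trans ltr01).
rewrite -q2.
have -> : (eta * D + r / q) ^+ 2 / 2 * q ^+ 2 =
  (eta * D) ^+ 2 / 2 * q ^+ 2 + eta * D * r * q + r ^+ 2 / 2 by field.
rewrite r2.
have : eta * D * r <= eta * D * r * q by rewrite ler_peMr// !mulr_ge0// ltW.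
by set u := eta * D * r; set v := u * q; lra.
Qed.

(** The first factor bounds the geometric sum over the counts of the best arm; the sum over times is
    left for the asymptotics, where the two regimes differ. *)
Definition dip_bound : R := 2 / (eta * D) ^+ 2 *
  \sum_(K <= n < N) expR (- beta n - eta * D * Num.sqrt (2 * beta n)).

Let sum_integral_under :
  \sum_(K <= n < N) \sum_(1 <= s < N) expR (- (dip n s ^+ 2 / 2 * s%:R)) <= dip_bound.
Proof.
rewrite /dip_bound mulr_sumr big_nat_cond [leRHS]big_nat_cond.
apply: ler_sum => n; rewrite andbT => nKN.
apply: (@le_trans _ _ (\sum_(1 <= s < N)
  expR (- beta n - eta * D * Num.sqrt (2 * beta n)) * expR (- ((eta * D) ^+ 2 / 2 * s%:R)))).
  rewrite big_nat_cond [leRHS]big_nat_cond.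
  by apply: ler_sum => s /andP[/andP[s0 _] _]; exact: integral_under_le.
rewrite -mulr_sumr mulrC ler_wpM2r ?expR_ge0// -[2 / _]invf_div.
by apply: sum_expRN_le; rewrite divr_gt0// exprn_gt0// mulr_gt0.
Qed.

Let regret_weight w : R :=
  \sum_(k | mu k < mu j) ((mu j - mu k) * burn k +
     \sum_(1 <= t < N) (mu j - mu k) * over k t w) +
  \sum_(K <= n < N) \sum_(1 <= s < N) G * under n s w.

(** With gaps replaced by [G] in the [under] terms, exchanging the sums over arms and times counts
    each time at most once, so no factor [K] appears. *)
Let weighted_draws_le w :
  \sum_k (mu j - mu k) * Num.max ((arm_count A N k w)%:R - 1) 0 <= regret_weight w.
Proof.
rewrite /regret_weight (bigID (fun k => mu k < mu j))/= [X in _ + X]big1 ?addr0; last first.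
  by move=> k; rewrite -leNgt => jk; rewrite (le_anti (introT andP (conj (mu_j k) jk))) subrr mul0r.
apply: (@le_trans _ _ (\sum_(k | mu k < mu j) ((mu j - mu k) * burn k +
     \sum_(1 <= t < N) (mu j - mu k) * over k t w) +
   \sum_(k | mu k < mu j) (\sum_(K <= n < N | A n w == k) \sum_(1 <= s < N) G * under n s w))).
  rewrite -big_split/=; apply: ler_sum => k kj.
  apply: (le_trans (ler_wpM2l (gap_ge0 k) (draws_le w kj))).
  rewrite !mulrDr mulr_sumr lerD2l mulr_sumr; apply: ler_sum => n _.
  rewrite mulr_sumr; apply: ler_sum => s _.
  by rewrite ler_wpM2r ?gap_le.
rewrite lerD2l.
have H0 n : 0 <= \sum_(1 <= s < N) G * under n s w.
  by apply: sumr_ge0 => s _; rewrite mulr_ge0// (le_trans (gap_ge0 j)).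
apply: (@le_trans _ _ (\sum_k \sum_(K <= n < N | A n w == k) \sum_(1 <= s < N) G * under n s w)).
  rewrite [leRHS](bigID (fun k => mu k < mu j))/= lerDl.
  by do 2 (apply: sumr_ge0 => ? _).
rewrite (exchange_big_dep xpredT)//=; apply: ler_sum => n _.
by rewrite (big_pred1 (A n w))// => k; rewrite eq_sym.
Qed.

Let G_ge0 : 0 <= G := le_trans (gap_ge0 j) (gap_le j).

Let integrates_regret_weight : ge0_integrates_to (P mu) regret_weight
  (\sum_(k | mu k < mu j) ((mu j - mu k) * burn k +
     \sum_(1 <= t < N) (mu j - mu k) * expR (- (dev k ^+ 2 / 2 * t%:R))) +
   \sum_(K <= n < N) \sum_(1 <= s < N) G * expR (- (dip n s ^+ 2 / 2 * s%:R))).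
Proof.
have int_over k t : ge0_integrates_to (P mu) (over k t) (expR (- (dev k ^+ 2 / 2 * t%:R))).
  by split; [exact: measurable_over|exact: over_ge0|exact: integral_weight].
have int_under n s : ge0_integrates_to (P mu) (under n s) (expR (- (dip n s ^+ 2 / 2 * s%:R))).
  split; [exact: measurable_under|exact: under_ge0|].
  (* The deviation of arm [j] is downward, so the tilt is [- dip n s]. *)
  by rewrite -sqrrN -(integral_weight j) /under sqrrN.
apply: ge0_integrates_toD; apply: ge0_integrates_to_sum => i _.
  apply: ge0_integrates_toD; first by apply: ge0_integrates_to_cst; rewrite mulr_ge0.
  by apply: ge0_integrates_to_sum => t _; exact: ge0_integrates_toZ.
by apply: ge0_integrates_to_sum => t _; exact: ge0_integrates_toZ.
Qed.

(** For each inferior arm, the gap times [burn k] plus the gap times [2 / dev k ^+ 2] is exactly its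
    summand in [r_coef mu] times the bracket. *)
Let integral_regret_weight_le : mu_star mu = mu j ->
  (\int[P mu]_w (regret_weight w)%:E <=
   (r_coef mu * (B / (1 - 2 * eta) ^+ 2 + (eta ^+ 2)^-1) + G * dip_bound)%:E)%E.
Proof.
move=> mus; have [_ _ ->] := integrates_regret_weight.
rewrite lee_fin lerD//; last first.
  apply: le_trans (ler_wpM2l G_ge0 sum_integral_under).
  by rewrite mulr_sumr; apply: ler_sum => n _; rewrite mulr_sumr.
rewrite /r_coef mus mulr_suml; apply: ler_sum => k kj.
have gap0 : 0 < mu j - mu k by rewrite subr_gt0.
have eta2 : 0 < 1 - 2 * eta by rewrite subr_gt0.
rewrite -mulr_sumr.
have dev2 : 0 < dev k ^+ 2 / 2 by rewrite divr_gt0// exprn_gt0// mulr_gt0.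
apply: (le_trans (lerD (lexx _) (ler_wpM2l (gap_ge0 k) (sum_expRN_le N dev2)))).
rewrite le_eqVlt; apply/orP; left; apply/eqP; rewrite /burn /dev; field.
by rewrite !gt_eqF.
Qed.

Lemma regret_le : mu_star mu = mu j ->
  (regret P A N mu <=
   (r_coef mu * (B / (1 - 2 * eta) ^+ 2 + (eta ^+ 2)^-1) + G * dip_bound)%:E)%E.
Proof.
move=> mus; apply: le_trans (integral_regret_weight_le mus).
have mmax k : measurable_fun setT (fun w => Num.max ((arm_count A N k w)%:R - 1) 0 : R).
  apply: measurable_maxr => //; apply: measurable_funB => //.
  by apply: measurable_arm_count; have [] := ucbA.
have mcount k : measurable_fun setT
    (fun w => (mu j - mu k) * Num.max ((arm_count A N k w)%:R - 1) 0 : R).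
  by apply: measurable_funM => //; exact: mmax.
have max_ge0 k w : 0 <= Num.max ((arm_count A N k w)%:R - 1) 0 :> R.
  by rewrite le_max lexx orbT.
apply: (@le_trans _ _ (\int[P mu]_w
    (\sum_k (mu j - mu k) * Num.max ((arm_count A N k w)%:R - 1) 0)%:E)%E).
  under eq_integral do rewrite -sumEFin.
  rewrite ge0_integral_sum//.
  - apply: lee_sum => k _; rewrite mus unlock.
    under [leRHS]eq_integral do rewrite EFinM.
    by rewrite ge0_integralZl ?lee_fin//; exact/measurable_EFinP/mmax.
  - by move=> k; apply/measurable_EFinP; exact: mcount.
  - by move=> k w _; rewrite lee_fin mulr_ge0.
apply: ge0_le_integral => //.
- by move=> w _; rewrite lee_fin sumr_ge0// => k _; rewrite mulr_ge0.
- by apply/measurable_EFinP; apply: measurable_sum => k; exact: mcount.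
- by apply/measurable_EFinP; have [] := integrates_regret_weight.
- by move=> w _; rewrite lee_fin weighted_draws_le.
Qed.

End fixed_horizon.

(** * Uniform estimates over the parameter set *)

Section theta.
Context (R : realType) (K : nat).
Hypothesis K_gt0 : (0 < K)%N.
Implicit Types mu : 'I_K -> R.

Lemma mu_star_max mu : exists j, mu_star mu = mu j /\ forall k, mu k <= mu j.
Proof.
have i0 : 'I_K := Ordinal K_gt0.
case: (@arg_maxP _ _ _ i0 xpredT mu isT) => j _ jmax.
have muj k : mu k <= mu j by exact: jmax.
exists j; split=> //; apply/le_anti/andP; split.
  by apply: ge_sup; [exists (mu i0), i0|move=> _ [k _ <-]].
by apply: ub_le_sup; [exists (mu j) => _ [k _ <-]|exists j].
Qed.

Lemma Theta_gap_le (D : R) mu k l : Theta D mu -> mu k - mu l <= 2 / D.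
Proof.
move=> [_ muD _].
have := le_trans (ler_norm (mu k)) (muD k).
have := muD l; rewrite -normrN => /(le_trans (ler_norm _)); lra.
Qed.

(** At least [D * K] arms are inferior, and each contributes at least [D] because gaps are at most
    [2 / D]. *)
Lemma r_coef_ge (D : R) mu : 0 < D -> Theta D mu -> D ^+ 2 * K%:R <= r_coef mu.
Proof.
move=> D0 muTheta; have [_ _ numD] := muTheta; have [j [mus muj]] := mu_star_max mu.
apply: (@le_trans _ _ (D * (num_inferior mu)%:R)).
  by rewrite expr2 -mulrA ler_pM2l.
rewrite /num_inferior mulr_natr -sumr_const /r_coef; apply: ler_sum => k.
rewrite inE mus => kj.
rewrite ler_pdivlMr ?subr_gt0// mulrC -ler_pdivlMr//.
exact: Theta_gap_le.
Qed.

End theta.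

(** [regret_le] with [G = 2 / D]: [r_coef mu] cancels in the main term and is replaced by its lower
    bound in the other, so nothing depends on [mu]. *)
Lemma sup_regret_ratio_le d (T : measurableType d) (R : realType) (K : nat)
    (P : ('I_K -> R) -> probability T R) (X : 'I_K -> nat -> {mfun T >-> R})
    (beta : nat -> R) (A : nat -> T -> 'I_K) (N : nat) (D B eta : R) :
  normal_bandit P X -> ucb_large X beta A N -> (0 < K)%N -> (K < N)%N -> 0 < D ->
  (forall n, (K <= n < N)%N -> 0 <= beta n) ->
  (forall n, (K <= n < N)%N -> beta n <= B) ->
  0 < eta -> 2 * eta < 1 ->
  (nneg_ereal_sup [set regret P A N mu * ((r_coef mu * ln N%:R)^-1)%:E | mu in Theta D]
   <= ((B / (1 - 2 * eta) ^+ 2 + (eta ^+ 2)^-1) / ln N%:R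
       + 2 * dip_bound K beta N D eta / (D ^+ 3 * K%:R * ln N%:R))%:E)%E.
Proof.
move=> PX ucbA K0 KN D0 beta0 betaB eta0 eta1.
have lnN : 0 < ln N%:R :> R by rewrite ln_gt0// ltr1n (leq_ltn_trans K0).
have KR : 0 < K%:R :> R by rewrite ltr0n.
have dip0 : 0 <= dip_bound K beta N D eta.
  rewrite /dip_bound mulr_ge0 ?divr_ge0 ?sqr_ge0//.
  by apply: sumr_ge0 => n _; exact: expR_ge0.
have B0 : 0 <= B.
  by apply: (@le_trans _ _ (beta K)); [apply: beta0|apply: betaB]; rewrite leqnn.
have c0 : 0 <= B / (1 - 2 * eta) ^+ 2 + (eta ^+ 2)^-1.
  by rewrite addr_ge0 ?divr_ge0 ?invr_ge0 ?sqr_ge0.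
(* Over an empty set the supremum is 0, so the bound must be nonnegative. *)
rewrite /nneg_ereal_sup; case: asboolP => _.
  rewrite lee_fin addr_ge0// divr_ge0 ?(ltW lnN)//; first by rewrite mulr_ge0.
  by rewrite !mulr_ge0 ?exprn_ge0 ?(ltW D0) ?(ltW lnN).
apply: ge_ereal_sup => _ [mu muTheta <-].
have [j [mus muj]] := mu_star_max K0 mu.
have rD := r_coef_ge K0 D0 muTheta.
have r0 : 0 < r_coef mu by rewrite (lt_le_trans _ rD)// mulr_gt0 ?exprn_gt0.
have gapD k : mu k < mu j -> D <= mu j - mu k.
  by have [+ _ _] := muTheta => /(_ k); rewrite mus => + /[dup] /[swap] => /[apply]; lra.
have rl0 : 0 < r_coef mu * ln N%:R by rewrite mulr_gt0.
apply: (le_trans (lee_wpmul2r _ (regret_le PX ucbA KN muj D0 gapD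
  (fun k => Theta_gap_le j k muTheta) beta0 betaB eta0 eta1 mus))).
  by rewrite lee_fin invr_ge0 ltW.
rewrite -EFinM lee_fin mulrDl lerD//.
  rewrite [(r_coef mu * _)^-1]invfM [leLHS]mulrACA divff ?mul1r//.
  by rewrite gt_eqF.
set p := dip_bound _ _ _ _ _ in dip0 *.
have -> : 2 * p / (D ^+ 3 * K%:R * ln N%:R) = 2 / D * p * (D ^+ 2 * K%:R * ln N%:R)^-1.
  by field; rewrite !gt_eqF.
apply: ler_wpM2l; first by rewrite mulr_ge0// divr_ge0// ltW.
rewrite lef_pV2 ?posrE ?mulr_gt0 ?exprn_gt0//.
by rewrite ler_pM2r.
Qed.

(** * Asymptotics *)

Lemma near_ln_ge_pinfty (R : realType) (c : R) : \forall x \near +oo, c <= ln x.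
Proof.
near=> x.
have cx : expR c <= x by near: x; apply: nbhs_pinfty_ge; exact: num_real.
by rewrite -[leLHS]expRK ler_ln ?posrE ?expR_gt0// (lt_le_trans (expR_gt0 c)).
Unshelve. all: by end_near. Qed.

Lemma near_ln_ge (R : realType) (c : R) : \forall n \near \oo, c <= ln n%:R.
Proof. exact: (cvgr_idn (near_ln_ge_pinfty c)). Qed.

Lemma limn_esup_le (R : realType) (u : nat -> \bar R) (c : R) :
  (forall e, 0 < e -> \forall n \near \oo, (u n <= (c + e)%:E)%E) ->
  (limn_esup u <= c%:E)%E.
Proof.
move=> uc; apply/lee_addgt0Pr => e e0; rewrite -EFinD.
have nearE := uc e e0.
apply: (@le_trans _ _ (ereal_sup [set u n | n in [set n | (u n <= (c + e)%:E)%E]])).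
  by apply: ereal_inf_lbound; exists [set n | (u n <= (c + e)%:E)%E].
by apply: ge_ereal_sup => _ [n /= un <-].
Qed.

(** Shared by both regimes: [eta] is fixed from [e] before [n] grows, so that
    [(eta ^+ 2)^-1 / ln n%:R] vanishes. *)
Lemma limn_esup_ucb_le (R : realType) (u : nat -> \bar R) (B : nat -> R)
    (S : R -> nat -> R) (c : R) : 0 <= c ->
  (forall e, 0 < e -> \forall n \near \oo, B n <= (c + e) * ln n%:R) ->
  (forall eta e, 0 < eta -> 0 < e -> \forall n \near \oo, S eta n <= e) ->
  (forall eta, 0 < eta -> 2 * eta < 1 -> \forall n \near \oo,
     (u n <= ((B n / (1 - 2 * eta) ^+ 2 + (eta ^+ 2)^-1) / ln n%:R + S eta n)%:E)%E) ->
  (limn_esup u <= c%:E)%E.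
Proof.
move=> c0 Bc Se uBS; apply: limn_esup_le => e e0.
(* The first bound gives [(1 - 2 * eta) ^- 2 <= 1 + 16 * eta] and [16 * eta <= 1], the second
   [16 * eta * c <= e / 4]. The errors are then [e / 4] and four times [e / 8]. *)
pose eta := Num.min (16^-1) (e / (64 * (c + 1))).
have e1 : 0 < e / 8 by rewrite divr_gt0.
have c1 : 0 < c + 1 by rewrite ltr_wpDl.
have eta0 : 0 < eta by rewrite lt_min invr_gt0 divr_gt0 ?mulr_gt0 ?andbT.
have eta16 : eta <= 16^-1 by rewrite ge_min lexx.
have etac : 16 * eta * c <= e / 4.
  have : eta <= e / (64 * (c + 1)) by rewrite ge_min lexx orbT.
  by rewrite ler_pdivlMr ?mulr_gt0//; nra.
have eta2 : 2 * eta < 1 by lra.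
have inv_le : ((1 - 2 * eta) ^+ 2)^-1 <= 1 + 16 * eta.
  rewrite -[leLHS]mul1r ler_pdivrMr ?exprn_gt0 ?subr_gt0//; nra.
near=> n.
have un : (u n <= ((B n / (1 - 2 * eta) ^+ 2 + (eta ^+ 2)^-1) / ln n%:R + S eta n)%:E)%E.
  by near: n; exact: uBS.
apply: (le_trans un); rewrite lee_fin.
have Sn : S eta n <= e / 8 by near: n; exact: Se.
have Bn : B n <= (c + e / 8) * ln n%:R by near: n; exact: Bc.
have ln1 : 1 <= ln n%:R :> R by near: n; exact: near_ln_ge.
have lne : (eta ^+ 2)^-1 / (e / 8) <= ln n%:R by near: n; exact: near_ln_ge.
have ln0 : 0 < ln n%:R :> R by rewrite (lt_le_trans ltr01).
have t1 : B n / (1 - 2 * eta) ^+ 2 / ln n%:R <= (c + e / 8) * (1 + 16 * eta).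
  rewrite mulrAC; apply: (@le_trans _ _ ((c + e / 8) / (1 - 2 * eta) ^+ 2)).
    by rewrite ler_wpM2r ?invr_ge0 ?sqr_ge0// ler_pdivrMr.
  by rewrite ler_wpM2l// addr_ge0// ltW.
have t2 : (eta ^+ 2)^-1 / ln n%:R <= e / 8.
  by rewrite ler_pdivrMr// mulrC -ler_pdivrMr.
rewrite mulrDl.
have : e / 8 * (16 * eta) <= e / 8 by rewrite ler_piMr ?(ltW e1)//; lra.
move: t1.
rewrite [X in _ <= X](_ : _ = c + 16 * eta * c + e / 8 + e / 8 * (16 * eta)); last by ring.
lra.
Unshelve. all: by end_near. Qed.

Lemma sum_harmonic_le (R : realType) (k n : nat) : (0 < k <= n)%N ->
  \sum_(k <= i < n) i%:R^-1 <= 1 + ln n%:R :> R.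
Proof.
move=> /andP[k0 kn].
suff H m : \sum_(1 <= i < m.+2) i%:R^-1 <= 1 + ln m.+1%:R :> R.
  apply: (@le_trans _ _ (\sum_(1 <= i < n.+1) i%:R^-1)).
    rewrite [leRHS](big_cat_nat (n := k))//= ?(leq_trans kn)//.
    rewrite [X in _ + X](big_cat_nat (n := n))//=.
    rewrite addrCA lerDl addr_ge0// sumr_ge0//.
  by case: n kn => [|n] kn; [move: k0; rewrite leqn0 in kn; rewrite (eqP kn)|exact: H].
elim: m => [|m IH]; first by rewrite big_nat1 invr1 ln1 addr0.
rewrite big_nat_recr//=; apply: (le_trans (lerD IH (lexx _))); rewrite -addrA lerD2l.
have m0 : 0 < m.+1%:R :> R by rewrite ltr0n.
have m1 : 0 < m.+2%:R :> R by rewrite ltr0n.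
(* This yields [1 / (m + 2) <= ln (m + 2) - ln (m + 1)]. *)
have := expR_ge1Dx (ln (m.+1%:R / m.+2%:R : R)).
rewrite lnK ?posrE ?divr_gt0// ln_div ?posrE//.
have -> : m.+1%:R / m.+2%:R = 1 - m.+2%:R^-1 :> R.
  by rewrite -[m.+1%:R](addrK 1) natr1 mulrBl divff ?mul1r// gt_eqF.
by move: (ln m.+1%:R) (ln m.+2%:R) (m.+2%:R^-1) => a b c; lra.
Qed.

(** A finite initial segment is bounded by its length, eventually at most [e / 4 * ln N]; the tail
    is compared with [e / 4] times the harmonic sum. *)
Lemma near_sum_le_ln (R : realType) (K0 : nat) (p : nat -> R) :
  (forall n, 0 <= p n <= 1) ->
  (forall e, 0 < e -> \forall n \near \oo, p n <= e / n%:R) ->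
  forall e, 0 < e -> \forall N \near \oo, \sum_(K0 <= n < N) p n <= e * ln N%:R.
Proof.
move=> p01 pe e e0.
have e4 : 0 < e / 4 by rewrite divr_gt0.
have [M _ HM] := pe _ e4.
near=> N.
have MN : (M.+1 <= N)%N by near: N; exact: nbhs_infty_ge.
have K0N : (K0 <= N)%N by near: N; exact: nbhs_infty_ge.
have ln1 : 1 <= ln N%:R :> R by near: N; exact: near_ln_ge.
have lnM : M.+1%:R / (e / 4) <= ln N%:R by near: N; exact: near_ln_ge.
have p0 n : 0 <= p n by have /andP[] := p01 n.
apply: (@le_trans _ _ (\sum_(0 <= n < N) p n)).
  by rewrite [leRHS](big_cat_nat (n := K0))//= lerDr sumr_ge0.
rewrite (big_cat_nat (n := M.+1))//=.
apply: (@le_trans _ _ (M.+1%:R + e / 4 * (1 + ln N%:R))).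
  apply: lerD.
    apply: (@le_trans _ _ (\sum_(0 <= n < M.+1) 1)).
      by apply: ler_sum => n _; have /andP[] := p01 n.
    by rewrite sumr_const_nat subn0.
  apply: (@le_trans _ _ (e / 4 * \sum_(M.+1 <= n < N) n%:R^-1)).
    rewrite mulr_sumr big_nat_cond [leRHS]big_nat_cond; apply: ler_sum => n.
    by move=> /andP[/andP[Mn _] _]; apply: HM; exact: ltnW.
  by rewrite ler_pM2l// sum_harmonic_le.
move: lnM; rewrite ler_pdivrMr// mulrC => lnM.
have : e / 4 <= e / 4 * ln N%:R by rewrite ler_peMr// ltW.
lra.
Unshelve. all: by end_near. Qed.

(** * Negligibility of the dips for growing [K] *)

Section growing_number_of_arms.
Variable R : realType.

(** The square root in the exponent is discarded. The harmonic sum cancels [ln N], leaving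
    [D ^- 5 * K ^- q], with [D ^- 3] from the ratio and [D ^- 2] from [dip_bound]; the fifth power
    form suits sub-polynomial decay at exponent [q / 5]. *)
Lemma dip_bound_ln_ratio_le (K N : nat) (q D eta : R) :
  (0 < K < N)%N -> 0 < D -> 0 < eta -> 1 <= ln N%:R :> R ->
  2 * dip_bound K (fun n => ln (n%:R / K%:R `^ (1 - q))) N D eta / (D ^+ 3 * K%:R * ln N%:R)
  <= 8 / (eta ^+ 2 * (D * K%:R `^ (q / 5)) ^+ 5).
Proof.
move=> /andP[K0 KN] D0 eta0 lnN.
have l0 : 0 < ln N%:R :> R by rewrite (lt_le_trans ltr01).
have KR : 0 < K%:R :> R by rewrite ltr0n.
have Kq : (K%:R `^ (q / 5)) ^+ 5 = K%:R `^ q.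
  by rewrite -powR_mulrn ?powR_ge0// -powRrM divfK// pnatr_eq0.
have K1q : K%:R `^ (1 - q) = K%:R / K%:R `^ q.
  by rewrite powRB ?(gt_eqF KR) ?implybT// powRr1// ltW.
have Kq0 : 0 < K%:R `^ q by exact: powR_gt0.
have sumle : \sum_(K <= n < N) expR (- ln (n%:R / K%:R `^ (1 - q)) -
    eta * D * Num.sqrt (2 * ln (n%:R / K%:R `^ (1 - q)))) <= 2 * ln N%:R * (K%:R / K%:R `^ q).
  apply: (@le_trans _ _ (\sum_(K <= n < N) n%:R^-1 * (K%:R / K%:R `^ q))).
    rewrite big_nat_cond [leRHS]big_nat_cond; apply: ler_sum => n /andP[/andP[Kn _] _].
    have n0 : 0 < n%:R :> R by rewrite ltr0n (leq_trans K0).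
    apply: (@le_trans _ _ (expR (- ln (n%:R / K%:R `^ (1 - q))))).
      by rewrite ler_expR gerBl !mulr_ge0 ?sqrtr_ge0 ?ltW.
    rewrite -lnV ?posrE ?divr_gt0 ?powR_gt0// lnK ?posrE ?invr_gt0 ?divr_gt0 ?powR_gt0//.
    by rewrite invf_div mulrC K1q.
  rewrite -mulr_suml ler_wpM2r ?divr_ge0 ?(ltW KR) ?(ltW Kq0)//.
  apply: (le_trans (sum_harmonic_le _ _)); first by rewrite K0 ltnW.
  lra.
rewrite /dip_bound [(D * _) ^+ 5]exprMn Kq.
set s := \sum_(_ <= n < _) _ in sumle *.
have e2 : 0 < eta ^+ 2 by rewrite exprn_gt0.
have d5 : 0 < D ^+ 5 by rewrite exprn_gt0.
have -> : 8 / (eta ^+ 2 * (D ^+ 5 * K%:R `^ q)) =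
  4 / (eta ^+ 2 * D ^+ 5 * K%:R * ln N%:R) * (2 * ln N%:R * (K%:R / K%:R `^ q)).
  by field; rewrite !gt_eqF.
have -> : 2 * (2 / (eta * D) ^+ 2 * s) / (D ^+ 3 * K%:R * ln N%:R) =
  4 / (eta ^+ 2 * D ^+ 5 * K%:R * ln N%:R) * s.
  by field; rewrite !gt_eqF.
by rewrite ler_wpM2l// divr_ge0// !mulr_ge0// ltW.
Qed.

End growing_number_of_arms.

(** * Negligibility of the dips for fixed [K] *)

Section fixed_number_of_arms.
Context (R : realType) (b : R -> R).
Hypothesis b_ge0 : {in `[1, +oo[, forall m, 0 <= b m}.
Hypothesis b_cvg : (b m - ln m) / Num.sqrt (ln m) @[m --> +oo] --> 0.

Lemma near_dist_ln_le (theta : R) : 0 < theta ->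
  \forall m \near +oo, `|b m - ln m| <= theta * Num.sqrt (ln m).
Proof.
move=> th0; move/cvgrPdist_le : b_cvg => /(_ _ th0) near_th.
near=> m.
have ln1 : 1 <= ln m by near: m; exact: near_ln_ge_pinfty.
have s0 : 0 < Num.sqrt (ln m) by rewrite sqrtr_gt0 (lt_le_trans ltr01).
have : `|0 - (b m - ln m) / Num.sqrt (ln m)| <= theta by near: m.
by rewrite sub0r normrN normrM normfV (gtr0_norm s0) ler_pdivrMr.
Unshelve. all: by end_near. Qed.

Lemma near_le_ln (e : R) : 0 < e -> \forall m \near +oo, b m <= (1 + e) * ln m.
Proof.
move=> e0; near=> m.
have ln1 : 1 <= ln m by near: m; exact: near_ln_ge_pinfty.
have : `|b m - ln m| <= e * Num.sqrt (ln m) by near: m; exact: near_dist_ln_le.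
have sl : Num.sqrt (ln m) <= ln m.
  rewrite -[leRHS]ger0_norm ?(le_trans ler01)// -sqrtr_sqr ler_wsqrtr//.
  by rewrite expr2 ler_peMr// (le_trans ler01).
have := ler_wpM2l (ltW e0) sl => h1 /(le_trans (ler_norm _)); lra.
Unshelve. all: by end_near. Qed.

(** With [r = sqrt (ln m)], eventually [b m >= r ^+ 2 - eps / 2 * r] and [sqrt (2 * b m) >= r]. The
    exponent is then at most [- ln m - eps / 2 * r], and [eps / 2 * r] outgrows [- ln e]. *)
Lemma near_expRN_le (eps e : R) : 0 < eps -> 0 < e ->
  \forall m \near +oo, expR (- b m - eps * Num.sqrt (2 * b m)) <= e / m.
Proof.
move=> eps0 e0; have eps2 : 0 < eps / 2 by rewrite divr_gt0.
near=> m.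
have m0 : 0 < m by near: m; apply: nbhs_pinfty_gt; exact: num_real.
have ln1 : 1 <= ln m by near: m; exact: near_ln_ge_pinfty.
have lneps : eps ^+ 2 <= ln m by near: m; exact: near_ln_ge_pinfty.
have lne : (ln e / (eps / 2)) ^+ 2 <= ln m by near: m; exact: near_ln_ge_pinfty.
have dist : `|b m - ln m| <= eps / 2 * Num.sqrt (ln m).
  by near: m; exact: near_dist_ln_le.
set L := ln m in ln1 lneps lne dist; set r := Num.sqrt L in dist.
have L0 : 0 <= L by rewrite (le_trans ler01).
have r2 : L = r ^+ 2 by rewrite sqr_sqrtr.
have r0 : 0 <= r := sqrtr_ge0 _.
have repsr : eps * r <= r ^+ 2.
  by rewrite expr2 ler_wpM2r// -ler_sqr ?nnegrE ?(ltW eps0)// -r2.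
have re : - ln e <= eps / 2 * r.
  rewrite mulrC -ler_pdivrMr// -[leRHS]ger0_norm// mulNr.
  by apply: (le_trans (ler_norm _)); rewrite normrN -ler_sqr ?nnegrE// !real_normK ?num_real// -r2.
have blow : L - eps / 2 * r <= b m.
  by move: dist; rewrite ler_norml => /andP[+ _]; lra.
have rb : r <= Num.sqrt (2 * b m) by rewrite ler_wsqrtr// r2; lra.
have := ler_wpM2l (ltW eps0) rb.
set x := Num.sqrt (2 * b m) => epsx.
rewrite -ler_ln ?posrE ?expR_gt0 ?divr_gt0// expRK ln_div ?posrE// -/L.
lra.
Unshelve. all: by end_near. Qed.

Variable K0 : nat.
Hypothesis K0_gt0 : (0 < K0)%N.

Let cvg_ratio : (n%:R / K0%:R : R) @[n --> \oo] --> +oo.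
Proof.
apply/cvgryPge => x; near=> n.
rewrite ler_pdivlMr ?ltr0n//.
by near: n; exact: nbhs_infty_ger.
Unshelve. all: by end_near. Qed.

Lemma near_ratio_le_ln (e : R) : 0 < e ->
  \forall N \near \oo, b (N%:R / K0%:R) <= (1 + e) * ln N%:R.
Proof.
move=> e0; near=> N.
have bN : b (N%:R / K0%:R) <= (1 + e) * ln (N%:R / K0%:R).
  by near: N; exact: (cvg_ratio (near_le_ln e0)).
have N0 : (0 < N)%N by near: N; exact: nbhs_infty_gt.
apply: (le_trans bN); rewrite ler_pM2l; last by rewrite ltr_wpDr// ltW.
have KR : 0 < K0%:R :> R by rewrite ltr0n.
rewrite ler_ln ?posrE ?divr_gt0 ?ltr0n// ler_pdivrMr//.
by rewrite ler_peMr// ler1n.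
Unshelve. all: by end_near. Qed.

Lemma near_dip_bound_ln_ratio_le (D eta e : R) : 0 < D -> 0 < eta -> 0 < e ->
  \forall N \near \oo,
    2 * dip_bound K0 (fun n => b (n%:R / K0%:R)) N D eta / (D ^+ 3 * K0%:R * ln N%:R) <= e.
Proof.
move=> D0 eta0 e0.
have KR : 0 < K0%:R :> R by rewrite ltr0n.
(* Below [K0] the argument of [b] is less than 1, where its sign is unknown; the value 0 keeps [p]
   within [[0, 1]]. *)
pose p n : R := if (K0 <= n)%N then
  expR (- b (n%:R / K0%:R) - eta * D * Num.sqrt (2 * b (n%:R / K0%:R))) else 0.
have etaD : 0 < eta * D by rewrite mulr_gt0.
have p01 n : 0 <= p n <= 1.
  rewrite /p; case: leqP => [Kn|_]; last by rewrite lexx ler01.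
  rewrite expR_ge0/= -[leRHS]expR0 ler_expR.
  have : 0 <= b (n%:R / K0%:R).
    by apply: b_ge0; rewrite in_itv/= andbT ler_pdivlMr// mul1r ler_nat.
  have : 0 <= eta * D * Num.sqrt (2 * b (n%:R / K0%:R)).
    by rewrite mulr_ge0 ?sqrtr_ge0 ?(ltW etaD).
  lra.
have pe e' : 0 < e' -> \forall n \near \oo, p n <= e' / n%:R.
  move=> e'0; have eK : 0 < e' / K0%:R by rewrite divr_gt0.
  near=> n.
  have n0 : (0 < n)%N by near: n; exact: nbhs_infty_gt.
  rewrite /p; case: ifPn => _; last by rewrite divr_ge0// ltW.
  have -> : e' / n%:R = e' / K0%:R / (n%:R / K0%:R).
    by field; rewrite !pnatr_eq0 -!lt0n n0 K0_gt0.
  by near: n; exact: (cvg_ratio (near_expRN_le etaD eK)).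
(* The inverse of the constant multiplying the sum over times, apart from [ln N]. *)
pose c := D ^+ 3 * K0%:R * (eta * D) ^+ 2 / 4.
have c0 : 0 < c by rewrite divr_gt0 ?mulr_gt0 ?exprn_gt0.
have ec : 0 < e * c by rewrite mulr_gt0.
near=> N.
have l1 : 1 <= ln N%:R :> R by near: N; exact: near_ln_ge.
have l0 : 0 < ln N%:R :> R by rewrite (lt_le_trans ltr01).
have : \sum_(K0 <= n < N) p n <= e * c * ln N%:R.
  by near: N; exact: (near_sum_le_ln K0 p01 pe).
have -> : \sum_(K0 <= n < N) p n = \sum_(K0 <= n < N)
    expR (- b (n%:R / K0%:R) - eta * D * Num.sqrt (2 * b (n%:R / K0%:R))).
  by apply: eq_big_nat => n /andP[Kn _]; rewrite /p Kn.
rewrite ler_pdivrMr ?mulr_gt0 ?exprn_gt0// /dip_bound.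
set s := \sum_(_ <= n < _) _ => sle.
have -> : 2 * (2 / (eta * D) ^+ 2 * s) = s * (4 / (eta * D) ^+ 2) by ring.
have -> : e * (D ^+ 3 * K0%:R * ln N%:R) = e * c * ln N%:R * (4 / (eta * D) ^+ 2).
  by rewrite /c; field; rewrite !gt_eqF.
by rewrite ler_wpM2r// divr_ge0// sqr_ge0.
Unshelve. all: by end_near. Qed.

End fixed_number_of_arms.

(** * Conclusion in the two regimes *)

Theorem theorem2 (R : realType) (K : nat -> nat) (zeta q : R) (b : R -> R)
    (Delta : nat -> R)
    (d : nat -> measure_display) (T : forall N, measurableType (d N))
    (P : forall N, ('I_(K N) -> R) -> probability (T N) R)
    (X : forall N, 'I_(K N) -> nat -> {mfun T N >-> R})
    (A : forall N, nat -> T N -> 'I_(K N))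
    (K_gt0 : forall N, (0 < K N)%N)
    (bandit : forall N, normal_bandit (P N) (X N))
    (regime :
      [/\ 0 < zeta < 1,
          K N @[N --> \oo] --> \oo,
          exists2 e : nat -> R, e N @[N --> \oo] --> 0 &
            \forall N \near \oo, (K N)%:R = N%:R `^ (zeta + e N),
          0 < q &
          forall N, ucb_large (X N)
            (fun n => ln (n%:R / (K N)%:R `^ (1 - q))) (A N) N]
      \/
      [/\ zeta = 0,
          exists K0, forall N, K N = K0,
          {in `[1, +oo[, forall m, 0 <= b m} /\
            {in `[1, +oo[ &, {homo b : m m' / m <= m'}},
          (b m - ln m) / Num.sqrt (ln m) @[m --> +oo] --> 0 &
          forall N, ucb_large (X N)
            (fun n => b (n%:R / (K N)%:R)) (A N) N])
    (Delta_gt0 : forall k, (0 < k)%N -> 0 < Delta k)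
    (Delta_subpoly : subpolynomial_to0 Delta) :
  (limn_esup (fun N =>
     nneg_ereal_sup [set regret (P N) (A N) N mu * ((r_coef mu * ln N%:R)^-1)%:E
          | mu in Theta (Delta (K N))])
   <= (1 - zeta + zeta * q)%:E)%E.
Proof.
have l0 : {near \oo, forall N, 0 < ln N%:R :> R}.
  near=> N; apply: (lt_le_trans (@ltr01 R)); near: N; exact: near_ln_ge.
case: regime => [[zeta01 Koo [e ecvg Ke] q0 ucbA]|].
  have [z0 z1] := andP zeta01.
  pose beta N n : R := ln (n%:R / (K N)%:R `^ (1 - q)).
  have lnK_eq : \forall N \near \oo, ln (K N)%:R = (zeta + e N) * ln N%:R :> R.
    by near=> N; rewrite -ln_powR; congr ln; near: N.
  have lnKlt : \forall N \near \oo, (K N < N)%N.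
    have z1' : 0 < 1 - zeta by rewrite subr_gt0.
    move/cvgrPdist_lt : ecvg => /(_ _ z1') ez1.
    near=> N.
    have lN : 0 < ln N%:R :> R by near: N.
    have N0 : (0 < N)%N by near: N; exact: nbhs_infty_gt.
    have : `|0 - e N| < 1 - zeta by near: N.
    rewrite sub0r normrN => /(le_lt_trans (ler_norm _)) eN.
    rewrite -(ltr_nat R) -ltr_ln ?posrE ?ltr0n//.
    have -> : ln (K N)%:R = (zeta + e N) * ln N%:R :> R by near: N.
    by rewrite gtr_pMl//; lra.
  apply: (limn_esup_ucb_le (B := fun N => beta N N)
    (S := fun eta N => 2 * dip_bound (K N) (beta N) N (Delta (K N)) eta
        / (Delta (K N) ^+ 3 * (K N)%:R * ln N%:R))).
  - by rewrite addr_ge0 ?mulr_ge0 ?subr_ge0 ?ltW.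
  - move=> a a0.
    (* [beta N N] equals [(1 - zeta + zeta * q - (1 - q) * e N) * ln N], so [e N] is made small
       against [1 - q]; adding 1 covers [q = 1]. *)
    have a1 : 0 < a / (`|1 - q| + 1) by rewrite divr_gt0// ltr_wpDl.
    move/cvgrPdist_le : ecvg => /(_ _ a1) ea.
    near=> N.
    have lN : 0 < ln N%:R :> R by near: N.
    have N0 : (0 < N)%N by near: N; exact: nbhs_infty_gt.
    have : `|0 - e N| <= a / (`|1 - q| + 1) by near: N.
    rewrite sub0r normrN ler_pdivlMr ?ltr_wpDl// => eN.
    have lnKN : ln (K N)%:R = (zeta + e N) * ln N%:R :> R by near: N.
    rewrite /beta ln_div ?posrE ?powR_gt0 ?ltr0n// ln_powR lnKN.
    have -> : ln N%:R - (1 - q) * ((zeta + e N) * ln N%:R) =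
      (1 - zeta + zeta * q - (1 - q) * e N) * ln N%:R by ring.
    rewrite ler_pM2r// lerD2l.
    apply: (le_trans (ler_norm _)); rewrite normrN normrM.
    by apply: le_trans eN; rewrite mulrC ler_wpM2l// lerDl.
  - move=> eta a eta0 a0.
    have q5 : 0 < q / 5 by rewrite divr_gt0.
    have Dq := Delta_subpoly.2 _ q5.
    have near_y y : \forall N \near \oo, y <= Delta (K N) * (K N)%:R `^ (q / 5).
      by move/cvgryPge : Dq => /(_ y) /Koo.
    near=> N.
    have lN : 1 <= ln N%:R :> R by near: N; exact: near_ln_ge.
    have KN : (0 < K N < N)%N by rewrite K_gt0; near: N.
    rewrite /beta; apply: (le_trans (dip_bound_ln_ratio_le q KN (Delta_gt0 _ (K_gt0 N)) eta0 lN)).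
    have y1 : 1 <= Delta (K N) * (K N)%:R `^ (q / 5) by near: N; exact: near_y.
    have ya : 8 / a / eta ^+ 2 <= Delta (K N) * (K N)%:R `^ (q / 5) by near: N; exact: near_y.
    set y := Delta (K N) * _ in y1 ya *.
    (* As [y >= 1], a linear lower bound on [y] suffices for the fifth power. *)
    have y5 : y <= y ^+ 5 by rewrite exprS ler_peMr ?exprn_ege1// (le_trans ler01).
    have eta2 : 0 < eta ^+ 2 by rewrite exprn_gt0.
    have y0 : 0 < y by rewrite (lt_le_trans ltr01).
    have den0 : 0 < eta ^+ 2 * y ^+ 5 by rewrite mulr_gt0// exprn_gt0.
    move: ya; rewrite !ler_pdivrMr// => /le_trans; apply.
    by rewrite mulrC ler_pM2l// mulrC ler_pM2l.
  - move=> eta eta0 eta1; near=> N.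
    have KN : (K N < N)%N by near: N.
    have KR : 0 < (K N)%:R :> R by rewrite ltr0n.
    apply: (sup_regret_ratio_le (bandit N) (ucbA N) (K_gt0 N) KN (Delta_gt0 _ (K_gt0 N))) => //.
    + move=> n /andP[Kn _].
      have n0 : 0 < n%:R :> R by rewrite ltr0n (leq_trans (K_gt0 N)).
      (* Nonnegativity of the exploration term reduces to [K ^ (1 - q) <= K <= n], by [q > 0]. *)
      rewrite ln_ge0// ler_pdivlMr ?powR_gt0// mul1r.
      apply: (@le_trans _ _ (K N)%:R); last by rewrite ler_nat.
      rewrite -[leRHS]powRr1 ?(ltW KR)// ler_powR ?ler1n//.
      by rewrite gerBl ltW.
    + move=> n /andP[Kn nN].
      have n0 : (0 < n)%N by rewrite (leq_trans (K_gt0 N)).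
      rewrite /beta ler_ln ?posrE ?divr_gt0 ?powR_gt0 ?ltr0n//.
        by rewrite ler_pM2r ?invr_gt0 ?powR_gt0// ler_nat ltnW.
      exact: ltn_trans nN.
move=> [zeta0 [K0 KE] [b_ge0 b_homo] b_cvg ucbA].
have K0_gt0 : (0 < K0)%N by rewrite -(KE 0%N).
have KR : 0 < K0%:R :> R by rewrite ltr0n.
have le1 n : (K0 <= n)%N -> (n%:R / K0%:R : R) \in `[1, +oo[.
  by move=> Kn; rewrite in_itv/= andbT ler_pdivlMr// mul1r ler_nat.
(* Here [Delta K0] is a positive constant, so its powers do not affect the limit. *)
apply: (limn_esup_ucb_le (B := fun N => b (N%:R / K0%:R))
  (S := fun eta N => 2 * dip_bound K0 (fun n => b (n%:R / K0%:R)) N (Delta K0) eta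
      / (Delta K0 ^+ 3 * K0%:R * ln N%:R))).
- by rewrite zeta0 subr0 mul0r addr0.
- move=> a a0; rewrite zeta0 subr0 mul0r addr0.
  exact: near_ratio_le_ln.
- move=> eta a eta0 a0; apply: near_dip_bound_ln_ratio_le => //.
  exact: Delta_gt0.
- move=> eta eta0 eta1; near=> N.
  have KN : (K0 < N)%N by near: N; exact: nbhs_infty_gt.
  rewrite -(KE N); apply: (sup_regret_ratio_le (bandit N) (ucbA N) (K_gt0 N) _
    (Delta_gt0 _ (K_gt0 N))) => //; rewrite KE//.
  + by move=> n /andP[Kn _]; exact/b_ge0/le1.
  + move=> n /andP[Kn nN]; apply: b_homo; rewrite ?le1//.
      by rewrite (leq_trans Kn)// ltnW.
    by rewrite ler_pM2r ?invr_gt0// ler_nat ltnW.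
Unshelve. all: by end_near. Qed.
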